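(* Let $X$ be a PDMP and $(X^n)_{n\in\mathbb{N}}$ a sequence of PDMPs on the same state space $E$ and with the same cemetery $E^c$, all satisfying the standing assumptions listed in the context, and let $\ell:E\to\mathbb{R}$ and $\Psi:E\to\mathbb{R}$ be a running reward function and a terminal cost function, respectively. Assume that both $\ell$ and $\Psi$ are continuous and bounded. Assume further that $X^n_0=x$ for all $n\in\mathbb{N}$ and $X_0=x$, and that $X^n\to X$ in distribution in $D([0,\infty),E)$. Let $\delta>0$, $\tau=\inf\{t\ge0:X_t\in E^c\}$ and $\tau^n=\inf\{t\ge0:X^n_t\in E^c\}$. Then $$\mathbb{E}_x\left(\int_0^{\tau^n}e^{-\delta t}\ell(X^n_t)\,dt+e^{-\delta\tau^n}\Psi(X^n_{\tau^n})\right)\to\mathbb{E}_x\left(\int_0^{\tau}e^{-\delta t}\ell(X_t)\,dt+e^{-\delta\tau}\Psi(X_{\tau})\right)$$ as $n\to\infty$.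
   Context: **Flows.** A flow on $A\subseteq\mathbb{R}^d$ is a continuous function $\phi:A\times\mathbb{R}\to\mathbb{R}^d$ with $\phi(x,0)=x$, and such that for $x\in A$, $s,t\in\mathbb{R}$: if $\phi(x,t)\in A$ and $\phi(\phi(x,t),s)\in A$ then $\phi(x,t+s)=\phi(\phi(x,t),s)$. Let $\partial^-_\phi A$ be the set of $x\in\partial A$ for which there is $\varepsilon>0$ with $\phi(x,t)\in A^\circ$ for all $t\in(0,\varepsilon)$, let $\partial^+_\phi A$ be the set of $x\in\partial A$ for which there is $\varepsilon>0$ with $\phi(x,-t)\in A^\circ$ for all $t\in(0,\varepsilon)$, and $\partial^1_\phi A=\partial^-_\phi A\setminus\partial^+_\phi A$. **State space and local characteristics.** $K$ is a finite set; for each $k\in K$, $E_k\subseteq\mathbb{R}^{d(k)}$ and $\phi_k$ is a flow on $E_k$ with $E_k=E_k^\circ\cup\partial^1_{\phi_k}E_k$. The state space is the disjoint union $E=\bigcup_{k\in K}(\{k\}\times E_k)$ with its Borel $\sigma$-algebra $\mathcal{E}$ (and the disjoint-union topology); the active boundary is $\Gamma^*=\bigcup_k\{k\}\times\partial^+_{\phi_k}E_k$. The jump intensity $\lambda=\{\lambda_k\}$ consists of measurable bounded $\lambda_k:E_k\to[0,\infty)$. The jump kernel $Q:\mathcal{E}\times(E\cup\Gamma^* )\to[0,1]$ is measurable in the second argument, $Q(\cdot,x)$ is a probability measure on $E$, and $Q(\{x\},x)=0$ for $x\in E$. The triple $(\phi,\lambda,Q)$ is called the local characteristics. Put $t^*(k,y)=\inf\{t>0:\phi_k(y,t)\in\partial^+_{\phi_k}E_k\}$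 (with $\inf\emptyset=\infty$). For $x=(k,y)$ write $\phi(x,t)=(k,\phi_k(y,t))$. **PDMP.** A piecewise deterministic Markov process (PDMP) with these data is an $E$-valued process $X$ for which there are jump times $0=T_0\le T_1\le T_2\le\dots$ in $[0,\infty]$ with $T_n\to\infty$ a.s., such that between jumps $X_t=\phi(X_{T_n},t-T_n)$ for $t\in[T_n,T_{n+1})$; given $X_s=(k,y)$ and $T_n\le s<T_{n+1}$, the remaining time to the next jump exceeds $t$ with probability $\exp(-\int_0^t\lambda_k(\phi_k(y,r))dr)$ if $0<t<t^*(k,y)$ and with probability $0$ if $t\ge t^*(k,y)$; and $\mathbb{P}(X_{T_{n+1}}\in A\mid X_{T_{n+1}-})=Q(A,X_{T_{n+1}-})$. It is a strong Markov process. $\mathbb{E}_x$ denotes expectation given that the process starts in $x$. **Standing assumptions (for every PDMP considered).** The flow comes from autonomous ODEs $\frac{\partial}{\partial t}\phi_k(y,t)=g_k(\phi_k(y,t))$ with Lipschitz continuous $g_k:\mathbb{R}^{d(k)}\to\mathbb{R}^{d(k)}$. Moreover $t^*(x)=\infty$ for all $x\in E$; $\lambda$ is bounded and continuous on $E$; and for every bounded continuous $f:E\to\mathbb{R}$ the map $x\mapsto\int_E f(\bar x)Q(d\bar x,x)$ is continuous. **Cemetery and costs.** A cemetery of a PDMP is a set $E^c=\bigcup_{k\in K^c}\{k\}\times E_k$, where $K^c\subseteq K$ is such that for all $k\in K^c$ one has $\lambda_k\equiv0$ and $\phi_k(y,t)=y$ for all $y\in E_k$, $t\in\mathbb{R}$.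 A running reward function is a measurable $\ell:E\to\mathbb{R}$ with $\ell=0$ on $E^c$. A terminal cost function is a measurable $\Psi:E\to\mathbb{R}$ with $\Psi=0$ on $E\setminus E^c$. On $\{\tau=\infty\}$ the term $e^{-\delta\tau}\Psi(X_\tau)$ is $0$. **Convergence.** $D([0,\infty),E)$ is the space of càdlàg functions $[0,\infty)\to E$ with the Skorokhod topology; convergence in distribution in this space means convergence of expectations of all bounded Skorokhod-continuous functionals. *)

(* Defs.v *)
From HB Require Import structures.
From mathcomp Require Import all_boot all_order all_algebra.
From mathcomp Require Import all_classical all_reals all_analysis.
From mathcomp Require Import measurable_realfun lra.

Set Implicit Arguments.
Unset Strict Implicit.
Unset Printing Implicit Defensive.

Import Order.TTheory GRing.Theory Num.Theory.
Import numFieldNormedType.Exports.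

Local Open Scope classical_set_scope.
Local Open Scope ring_scope.

(** * The disjoint-union uniformity on [{i & X i}]
    It induces the disjoint-union topology that the library puts on this type
    (lemma [sigT_nbhs_ent]). *)

Section sigT_uniform.
Context {I : choiceType} {X : I -> uniformType}.

Definition sigT_slice (A : set ({i & X i} * {i & X i})) (i : I) :
    set (X i * X i)%type :=
  [set p | A (existT X i p.1, existT X i p.2)].
Arguments sigT_slice A i : clear implicits.

Definition sigT_ent : set_system ({i & X i} * {i & X i}) :=
  [set A | forall i, entourage (sigT_slice A i)].

Let glue (B : forall i, set (X i * X i)) : set ({i & X i} * {i & X i}) :=
  [set p | exists i (u v : X i), p = (existT X i u, existT X i v) /\ B i (u, v)].

Lemma sigT_ent_filter : Filter sigT_ent.
Proof.
split=> [i|A B entA entB i|A B AB entA i].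
- by apply: filterS (@entourageT (X i)).
- exact: filterI (entA i) (entB i).
- by apply: filterS (entA i) => p; exact: AB.
Qed.

Lemma sigT_ent_diagonal A : sigT_ent A -> diagonal `<=` A.
Proof.
move=> entA [x [i u]] xE; rewrite (xE : x = _).
exact: (entourage_refl u (entA i)).
Qed.

Lemma sigT_ent_inv A : sigT_ent A -> sigT_ent A^-1%relation.
Proof. by move=> entA i; exact: entourage_inv (entA i). Qed.

Lemma sigT_ent_split A : sigT_ent A ->
  exists2 B, sigT_ent B & (B \; B `<=` A)%relation.
Proof.
move=> entA; exists (glue (fun i => split_ent (sigT_slice A i))).
  move=> i; apply: filterS (entourage_split_ent (entA i)) => -[u v] uv.
  by exists i, u, v.
move=> [x z] /= [y [i [u [v [[-> ->] uv]]]] [j [v' [w [[e + ->] vw]]]]].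
case: _ / e v' w vw => v' w vw e.
have {e}e := existT_inj2 e.
apply: (@subset_split_ent _ _ (entA i) (u, w)) => /=.
by exists v => //=; rewrite e.
Qed.

Lemma sigT_nbhs_ent : @nbhs _ {i & X i} = nbhs_ sigT_ent.
Proof.
rewrite funeqE => -[i u]; rewrite predeqE => U; split.
  rewrite /nbhs /= sigT_nbhsE /= nbhs_simpl /= => -/nbhsP[V entV VU].
  exists [set p | p.1 = existT X i u -> U p.2]; last first.
    by move=> y /xsectionP; exact.
  move=> j; have [e|ne] := pselect (j = i); last first.
    by apply: filterS (@entourageT (X j)) => p _ /= e;
      case: ne; exact: existT_inj1 e.
  case: _ / (esym e); apply: filterS entV => -[a b] Vab /= e'.
  have au := existT_inj2 e'.
  by apply: VU; apply/xsectionP; rewrite -au.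
move=> [A entA AU]; rewrite /nbhs /= sigT_nbhsE /= nbhs_simpl /=.
apply/nbhsP; exists (sigT_slice A i) => // v /xsectionP Av.
by apply: AU; apply/xsectionP.
Qed.

HB.instance Definition _ := Nbhs_isUniform_mixin.Build {i & X i}
  sigT_ent_filter sigT_ent_diagonal sigT_ent_inv sigT_ent_split sigT_nbhs_ent.

End sigT_uniform.

(** * The Skorokhod space [D([0, oo), U)] *)

Section skorokhod.
Context {R : realType}.

(* Paths are functions on [R] that are constant on the negative half-line, so
   that they correspond bijectively to functions on [0, oo). *)
Definition cadlag {U : topologicalType} (f : R -> U) : Prop :=
  [/\ forall t, 0 <= t -> f s @[s --> t^'+] --> f t,
      forall t, 0 < t -> exists l : U, f s @[s --> t^'-] --> l
    & forall t, t < 0 -> f t = f 0].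

Record skorokhod (U : topologicalType) :=
  Skorokhod { path :> R -> U ; path_cadlag : cadlag path }.

Definition nonneg_half : set R := [set t | 0 <= t].

Definition time_change (mu : R -> R) : Prop :=
  set_bij nonneg_half nonneg_half mu /\
  {in nonneg_half &, {homo mu : s t / s < t}}.

Context {U : uniformType}.

Definition skorokhod_close (T e : R) (A : set (U * U)) :
    set (skorokhod U * skorokhod U) :=
  [set fg : skorokhod U * skorokhod U | exists2 mu : R -> R, time_change mu &
    forall t, 0 <= t <= T -> `|mu t - t| < e /\ A (fg.1 t, fg.2 (mu t))].

(* For metrizable [U] this is the classical Skorokhod (J1) topology: [f_n --> f]
   iff for every [T] there are time changes [mu_n] with
   [sup_(t <= T) `|mu_n t - t| --> 0] and
   [sup_(t <= T) dist (f t) (f_n (mu_n t)) --> 0].  It depends on the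
   uniformity of [U] only through its topology. *)
Definition skorokhod_ent : set_system (skorokhod U * skorokhod U) :=
  [set W | exists T e A,
    [/\ 0 <= T, 0 < e, entourage A & skorokhod_close T e A `<=` W]].

Lemma time_change_id : time_change id.
Proof.
by split=> //; split=> // t t0; exists t.
Qed.

Lemma time_change_comp mu nu :
  time_change mu -> time_change nu -> time_change (nu \o mu).
Proof.
move=> [mub mui] [nub nui]; split; first exact: set_bij_comp mub nub.
have mu0 t : t \in nonneg_half -> mu t \in nonneg_half.
  by case: mub => fmu _ _; rewrite !inE; exact: fmu.
by move=> s t s0 t0 st /=; apply: nui; [exact: mu0|exact: mu0|exact: mui].
Qed.

Lemma time_change_inv mu : time_change mu ->
  exists2 nu, time_change nu &
    (forall t, 0 <= t -> nu (mu t) = t) /\ (forall t, 0 <= t -> mu (nu t) = t).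
Proof.
move=> [[fmu imu smu] mui].
have /choice[nu nuP] t : exists s, 0 <= t -> 0 <= s /\ mu s = t.
  have [t0|t0] := pselect (0 <= t); last by exists 0.
  by have [s s0 st] := smu t t0; exists s.
have nuK t : 0 <= t -> nu (mu t) = t.
  move=> t0; have [n0 nt] := nuP _ (fmu t t0).
  by apply: imu nt; rewrite inE.
exists nu; last by split=> // t /nuP[].
split; first split.
- by move=> t /nuP[].
- move=> s t; rewrite !inE => /nuP[_ es] /nuP[_ et] st.
  by rewrite -es -et st.
- by move=> t t0; exists (mu t); [exact: fmu|exact: nuK].
move=> s t; rewrite !inE => /nuP[s0 es] /nuP[t0 et] st.
rewrite ltNge le_eqVlt; apply/negP => /orP[/eqP ts|ts].
  by move: st; rewrite -es -et ts ltxx.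
have := mui (nu t) (nu s); rewrite !inE => /(_ t0 s0 ts).
by rewrite es et; move=> /(lt_trans st); rewrite ltxx.
Qed.

Lemma skorokhod_ent_filter : Filter skorokhod_ent.
Proof.
split=> [|V W|V W VW].
- by exists 0, 1, setT; split=> //; exact: entourageT.
- move=> [T [e [A [T0 e0 entA AV]]]] [T' [e' [B [T'0 e'0 entB BW]]]].
  exists (Num.max T T'), (Num.min e e'), (A `&` B); split.
  + by rewrite le_max T0.
  + by rewrite lt_min e0.
  + exact: filterI.
  + move=> fg [mu tcmu fgP]; split.
      apply: AV; exists mu => // t /andP[t0 tT].
      have [|me [At _]] := fgP t; first by rewrite t0 le_max tT.
      by split=> //; rewrite (lt_le_trans me)// ge_min lexx.
    apply: BW; exists mu => // t /andP[t0 tT].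
    have [|me [_ Bt]] := fgP t; first by rewrite t0 le_max tT orbT.
    by split=> //; rewrite (lt_le_trans me)// ge_min lexx orbT.
- move=> [T [e [A [T0 e0 entA AV]]]]; exists T, e, A; split=> //.
  exact: subset_trans AV VW.
Qed.

Lemma skorokhod_ent_diagonal W : skorokhod_ent W -> diagonal `<=` W.
Proof.
move=> [T [e [A [T0 e0 entA AW]]]] [f g] fg; rewrite (fg : f = _).
apply: AW; exists id; first exact: time_change_id.
by move=> t _; rewrite subrr normr0; split=> //; exact: entourage_refl.
Qed.

Lemma skorokhod_ent_inv W : skorokhod_ent W -> skorokhod_ent W^-1%relation.
Proof.
move=> [T [e [A [T0 e0 entA AW]]]].
exists (T + e), e, A^-1%relation; split=> //.
  by rewrite addr_ge0// ltW.
move=> [f g] [mu tcmu fgP]; apply: AW => /=.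
have [nu tcnu [nuK muK]] := time_change_inv tcmu.
exists nu => // s /andP[s0 sT] /=.
have n0 : 0 <= nu s by case: tcnu => -[fnu _ _] _; exact: fnu.
have nT : nu s <= T + e.
  rewrite leNgt; apply/negP => lt_n.
  have [|] := fgP (T + e); first by rewrite lexx andbT addr_ge0// ltW.
  case: tcmu => _ /(_ (T + e) (nu s)); rewrite !inE muK// => mui.
  have /mui/(_ n0 lt_n) : nonneg_half (T + e) by apply: addr_ge0; rewrite // ltW.
  by move=> mTs; rewrite ltr_norml => /andP[]; lra.
have [|] := fgP (nu s); first by rewrite n0.
by rewrite muK//= distrC.
Qed.

Lemma skorokhod_ent_split W : skorokhod_ent W ->
  exists2 V, skorokhod_ent V & (V \; V `<=` W)%relation.
Proof.
move=> [T [e [A [T0 e0 entA AW]]]].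
exists (skorokhod_close (T + e) (e / 2) (split_ent A)).
  exists (T + e), (e / 2), (split_ent A); split=> //.
  - by rewrite addr_ge0// ltW.
  - by rewrite divr_gt0.
move=> [f h] /= [g [mu tcmu fgP] [nu tcnu ghP]]; apply: AW.
exists (nu \o mu); first exact: time_change_comp.
move=> t /andP[t0 tT] /=.
have [|mt Af] := fgP t; first by rewrite t0/=; lra.
have m0 : 0 <= mu t by case: tcmu => -[fmu _ _] _; exact: fmu.
have [|nt Ag] := ghP (mu t).
  by rewrite m0/=; move: mt; rewrite ltr_norml => /andP[]; lra.
split; last by apply: (subset_split_ent entA); exists (g (mu t)).
by move: mt nt; rewrite !ltr_norml => /andP[? ?] /andP[? ?]; lra.
Qed.

End skorokhod.

Arguments skorokhod R U : clear implicits.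

Section skorokhod_instances.
Context {R : realType}.
HB.instance Definition _ (U : topologicalType) := gen_eqMixin (skorokhod R U).
HB.instance Definition _ (U : topologicalType) :=
  gen_choiceMixin (skorokhod R U).
HB.instance Definition _ (U : uniformType) := isUniform.Build (skorokhod R U)
  skorokhod_ent_filter skorokhod_ent_diagonal skorokhod_ent_inv
  skorokhod_ent_split.
End skorokhod_instances.

(** * Flows *)

Section flow.
Context {R : realType} {n : nat}.
Implicit Types (A : set 'rV[R]_n) (phi : 'rV[R]_n -> R -> 'rV[R]_n).

(* Flows are total functions, so that they can also be evaluated at boundary
   points of [A] outside [A], as [bd_out] below requires. *)
Definition is_flow A phi : Prop :=
  [/\ {within A `*` [set: R],
        continuous (fun p : 'rV[R]_n * R => phi p.1 p.2)},
      forall x, A x -> phi x 0 = x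
    & forall x s t, A x -> A (phi x t) -> A (phi (phi x t) s) ->
        phi x (t + s) = phi (phi x t) s].

Definition bd A : set 'rV[R]_n := closure A `\` A°.

Definition bd_in phi A : set 'rV[R]_n :=
  [set x | bd A x /\
    exists2 e : R, 0 < e & forall t, 0 < t < e -> A° (phi x t)].

Definition bd_out phi A : set 'rV[R]_n :=
  [set x | bd A x /\
    exists2 e : R, 0 < e & forall t, 0 < t < e -> A° (phi x (- t))].

Definition bd_one phi A : set 'rV[R]_n := bd_in phi A `\` bd_out phi A.

End flow.

(** * State space *)

Section state_space.
Context {R : realType}.

(* [base] only serves to make [state] inhabited, as required by the library's
   measurable types. *)
Record state_space := StateSpace {
  mode : finType ;
  dim : mode -> nat ;
  region : forall k : mode, set 'rV[R]_(dim k) ;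
  base : {k : mode & set_type (@region k)} }.

Definition state (S : state_space) : Type :=
  {k : mode S & set_type (@region S k)}.

HB.instance Definition _ S := Uniform.copy (state S)
  {k : mode S & set_type (@region S k)}.
HB.instance Definition _ S := isPointed.Build (state S) (base S).
HB.instance Definition _ S := Measurable.copy (state S)
  (g_sigma_algebraType (@open (state S))).

Definition pt (S : state_space) (k : mode S) (y : set_type (@region S k)) :
  state S := existT _ k y.

Definition coord (S : state_space) (x : state S) : 'rV[R]_(dim (tag x)) :=
  set_val (tagged x).

Definition ambient (S : state_space) (x : state S) :
  {k : mode S & 'rV[R]_(dim k)} := existT _ (tag x) (coord x).

Definition flow_family (S : state_space) : Type :=
  forall k : mode S, 'rV[R]_(dim k) -> R -> 'rV[R]_(dim k).

Definition active (S : state_space) (phi : flow_family S) (k : mode S) :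
    set 'rV[R]_(dim k) :=
  bd_out (phi k) (@region S k).

(* [state (with_active phi)] is the space [E `|` Gamma^*]. *)
Definition add_active (S : state_space) (phi : flow_family S) (x : state S) :
    {k : mode S & set_type (@region S k `|` active phi (k := k))} :=
  existT _ (tag x)
    (SigSub (mem_set (or_introl (set_mem (valP (tagged x)))))).

Definition with_active (S : state_space) (phi : flow_family S) : state_space :=
  StateSpace (add_active phi (base S)).

Definition incl (S : state_space) (phi : flow_family S) (x : state S) :
  state (with_active phi) := add_active phi x.

End state_space.
Arguments state_space R : clear implicits.
Arguments region {R} s k.
Arguments active {R S} phi k.

(** * Local characteristics *)

Section characteristics.
Context {R : realType}.

Record characteristics (S : state_space R) := Characteristics {
  flow : flow_family S ;
  intensity : state S -> R ;
  kern : R.-pker (state (with_active flow)) ~> (state S) ;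
  flowP : forall k, is_flow (region S k) (@flow k) ;
  regionE : forall k,
    region S k = (region S k)° `|` bd_one (@flow k) (region S k) ;
  intensity_ge0 : forall x, 0 <= intensity x ;
  intensity_measurable : measurable_fun [set: state S] intensity ;
  intensity_bounded : bounded_fun intensity ;
  kern_moves : forall x, kern (incl flow x) [set x] = 0%E }.
Arguments flow {S} c k _ _.

Context {S : state_space R}.
Implicit Type C : characteristics S.

(* phi (x, t) *)
Definition flow_at C (x : state S) (t : R) :
  {k : mode S & 'rV[R]_(dim k)} :=
  existT _ (tag x) (flow C (tag x) (coord x) t).

(* the time t^* *)
Definition exit_time C (x : state S) : \bar R :=
  ereal_inf [set t%:E | t in
    [set t | 0 < t /\ active (flow C) (tag x) (flow C (tag x) (coord x) t)]].

(* The intensity along the flow; for [0 <= t < exit_time x] the flow started in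
   [x] is in the region, so the default value [0] is not used there. *)
Definition intensity_along C (x : state S) (t : R) : R :=
  valL_ 0 (fun y : set_type (region S (tag x)) => intensity C (pt y))
    (flow C (tag x) (coord x) t).

Definition survival C (x : state S) (t : R) : R :=
  if (t%:E < exit_time C x)%E
  then expR (- \int[lebesgue_measure]_(r in `[0, t]) intensity_along C x r)
  else 0.

(* The ODE holds for every starting point in [R^d(k)]: the flow is the
   restriction of the global flow of the Lipschitz vector field. *)
Definition standing_assumptions C : Prop :=
  [/\ exists g : forall k : mode S, 'rV[R]_(dim k) -> 'rV[R]_(dim k),
        forall k, lipschitz (g k) /\
          forall (y : 'rV[R]_(dim k)) (t : R),
            is_derive t 1 (flow C k y) (g k (flow C k y t)),
      forall x, exit_time C x = +oo%E,
      bounded_fun (intensity C) /\ continuous (intensity C)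
    & forall f : state S -> R, continuous f -> bounded_fun f ->
        continuous (fun x => \int[kern C (incl (flow C) x)]_z f z)].

Definition cemetery (Kc : {set mode S}) : set (state S) :=
  [set x | tag x \in Kc].

Definition is_cemetery C (Kc : {set mode S}) : Prop :=
  forall x, cemetery Kc x -> intensity C x = 0 /\
    forall t, flow C (tag x) (coord x) t = coord x.

Definition running_reward (Kc : {set mode S}) (l : state S -> R) : Prop :=
  measurable_fun [set: state S] l /\ forall x, cemetery Kc x -> l x = 0.

Definition terminal_cost (Kc : {set mode S}) (Psi : state S -> R) : Prop :=
  measurable_fun [set: state S] Psi /\
  forall x, ~ cemetery Kc x -> Psi x = 0.

End characteristics.

(** * Processes *)

Section process.
Context {R : realType} {S : state_space R}.
Context {d : measure_display} {Om : measurableType d}.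
Variables (P : probability Om R) (X : Om -> skorokhod R (state S)).

Definition history (t : R) : set (set Om) :=
  <<s [set A | exists s B, [/\ 0 <= s <= t, measurable B &
                            A = [set w | B (X w s)]] ] >>.

Definition stopping_time (sigma : Om -> \bar R) : Prop :=
  (forall w, 0 <= sigma w)%E /\
  forall t, 0 <= t -> history t [set w | (sigma w <= t%:E)%E].

Definition stopped_history (sigma : Om -> \bar R) : set (set Om) :=
  [set A | forall t, 0 <= t ->
    history t (A `&` [set w | (sigma w <= t%:E)%E])].

(* strong Markov property, with some transition kernels [p t] *)
Definition strong_markov : Prop :=
  exists p : R -> R.-pker (state S) ~> (state S),
  forall sigma A t B, stopping_time sigma -> stopped_history sigma A ->
    0 <= t -> measurable B ->
    let D := A `&` [set w | (sigma w < +oo)%E] in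
    P (D `&` [set w | B (X w (fine (sigma w) + t))]) =
    (\int[P]_(w in D) p t (X w (fine (sigma w))) B)%E.

Variable C : characteristics S.

(* [T n] is the n-th jump time and [Y n] the left limit of [X] at [T n.+1]. *)
Definition is_pdmp : Prop :=
  [/\ forall t, measurable_fun [set: Om] (fun w => X w t),
      strong_markov
    & exists (T : nat -> Om -> \bar R)
             (Y : nat -> Om -> state (with_active (flow C))),
      [/\ (forall n, measurable_fun [set: Om] (T n)) /\
          (forall n, measurable_fun [set: Om] (Y n)),
          forall w, T 0%N w = 0%E /\ (forall n, T n w <= T n.+1 w)%E,
          {ae P, forall w,
            [/\ T ^~ w @ \oo --> +oo%E,
                forall n t, (T n w <= t%:E < T n.+1 w)%E ->
                  ambient (X w t) =
                  flow_at C (X w (fine (T n w))) (t - fine (T n w))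
              & forall n, (0 < T n.+1 w < +oo)%E ->
                  incl (flow C) (X w s) @[s --> (fine (T n.+1 w))^'-]
                    --> Y n w]},
          forall n s t B, 0 <= s -> 0 < t -> measurable B ->
            let D := [set w | B (X w s) /\ (T n w <= s%:E < T n.+1 w)%E] in
            P (D `&` [set w | ((s + t)%:E < T n.+1 w)%E]) =
            (\int[P]_(w in D) (survival C (X w s) t)%:E)%E
        & forall n A B, measurable A -> measurable B ->
            let D := [set w | B (Y n w) /\ (0 < T n.+1 w < +oo)%E] in
            P (D `&` [set w | A (X w (fine (T n.+1 w)))]) =
            (\int[P]_(w in D) kern C (Y n w) A)%E]].

End process.

Definition cvg_in_distribution {R : realType} {U : uniformType}
    (d : measure_display) (Om : measurableType d) (P : probability Om R)
    (X : Om -> U)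
    (dn : nat -> measure_display) (Omn : forall n, measurableType (dn n))
    (Pn : forall n, probability (Omn n) R) (Xn : forall n, Omn n -> U) : Prop :=
  forall F : U -> R, continuous F -> bounded_fun F ->
    ('E_(Pn n)[F \o Xn n])%E @[n --> \oo] --> ('E_P[F \o X])%E.

Section reward.
Context {R : realType} {S : state_space R}.

Definition hitting_time (Kc : {set mode S}) (f : skorokhod R (state S)) :
    \bar R :=
  ereal_inf [set t%:E | t in [set t | 0 <= t /\ cemetery Kc (f t)]].

Definition total_reward (Kc : {set mode S}) (delta : R) (l Psi : state S -> R)
    (f : skorokhod R (state S)) : R :=
  let tau := hitting_time Kc f in
  \int[lebesgue_measure]_(t in [set t | 0 <= t /\ (t%:E <= tau)%E])
    (expR (- delta * t) * l (f t)) +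
  (if (tau < +oo)%E then expR (- delta * fine tau) * Psi (f (fine tau)) else 0).

End reward.

(* Main.v *)
Require Import Defs.
From mathcomp Require Import all_boot all_order all_algebra.
From mathcomp Require Import all_classical all_reals all_analysis.
From mathcomp Require Import measurable_realfun ring lra.

Set Implicit Arguments.
Unset Strict Implicit.
Unset Printing Implicit Defensive.

Import Order.TTheory GRing.Theory Num.Theory.
Import numFieldNormedType.Exports.

Local Open Scope classical_set_scope.
Local Open Scope ring_scope.

(** The stopped reward is an integral over the whole half-line, with no stopping
    time in it.  A path that enters the cemetery stays at its entry point from
    the hitting time tau on, so the lump sum Psi(X_tau) paid at tau is worth as
    much as the perpetual payment delta * Psi(X_t) over t >= tau:
      e^(- delta tau) Psi(X_tau) = int_tau^oo e^(- delta t) delta Psi(X_t) dt.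
    Before tau the function Psi vanishes, and after tau the function l does.
    Hence, for almost every path, the reward equals
      G(f) = int_0^oo e^(- delta t) (l + delta Psi)(f t) dt
    ([total_reward_absorbed]).  The functional G is bounded and continuous for
    the Skorokhod topology, so convergence in distribution applies to it.

    Continuity of G ([discounted_value_continuous]): on a bounded time interval
    a cadlag path oscillates by less than epsilon near every time, except across
    finitely many instants, and this survives a small change of the values and
    a small time change ([cadlag_osc]).  If g is Skorokhod-close to f, the
    integrands of G(f) and G(g) therefore differ by little, except within a
    short distance of those instants and at late times; both exceptions
    contribute little to the integral ([discounted_integral_small]).

    Absorption ([pdmp_absorbed]): the intensity vanishes on the cemetery and no
    boundary is ever reached, so the survival function there is identically 1
    and a process seen in the cemetery at a rational time has almost surely no
    further jump.  Flows preserve the mode, so every inter-jump interval that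
    meets the cemetery contains such a rational time, and from its left end on
    the path is constant.

    The two expectations agree because almost everywhere equal functions have
    the same integral, whether or not they are measurable functions of the
    outcome ([integral_ae_eq]). *)

(** * Measurability of paths and discounting *)

(** [f] is the pointwise limit of the functions taking at [t] the value of [f]
    at the first multiple of [1 / n] beyond [t]. *)
Lemma right_continuous_measurable {R : realType} (f : R -> R) :
  (forall t, 0 <= t -> f s @[s --> t^'+] --> f t) ->
  measurable_fun (`[0, +oo[ : set R) f.
Proof.
move=> frc.
pose up n (t : R) := (Num.truncn (n.+1%:R * t)).+1%:R / n.+1%:R : R.
have upP n t : 0 <= t -> t < up n t <= t + n.+1%:R^-1.
  move=> t0.
  have /truncn_itv/andP[lo hi] : 0 <= n.+1%:R * t by rewrite mulr_ge0.
  rewrite /up ltr_pdivlMr// ler_pdivrMr// mulrDl mulVf// (mulrC t) hi/=.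
  by rewrite -natr1 lerD2r.
apply: (@measurable_fun_cvg _ _ _ _ (fun n => f \o up n)) => [n|t].
  move=> _ Y mY.
  rewrite (_ : _ `&` _ = \bigcup_(k in [set k | Y (f (k.+1%:R / n.+1%:R))])
      [set` `[(k%:R / n.+1%:R : R), k.+1%:R / n.+1%:R[]).
    by apply: bigcup_measurable => k _; exact: measurable_itv.
  apply/seteqP; split=> [t|t [k /= Yk]].
    rewrite /= in_itv/= andbT => -[t0 Yt].
    exists (Num.truncn (n.+1%:R * t)) => //=.
    have /truncn_itv/andP[lo hi] : 0 <= n.+1%:R * t by rewrite mulr_ge0.
    by rewrite in_itv/= ler_pdivrMr// ltr_pdivlMr// (mulrC t) lo hi.
  rewrite !in_itv/= => /andP[lo hi]; rewrite andbT; split.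
    by rewrite (le_trans _ lo)// divr_ge0.
  rewrite /up (@truncn_def _ _ k)// mulrC -ler_pdivrMr// lo/=.
  by rewrite -ltr_pdivlMr.
rewrite /= in_itv/= andbT => t0.
apply: (cvg_at_rightP f t (f t)).1 (frc t t0) _ _.
split=> [n|]; first by have /andP[] := upP n t t0.
apply: (@squeeze_cvgr _ _ _ _ (cst t) (fun n => t + n.+1%:R^-1)).
- by near=> n; have /andP[/ltW -> ->] := upP n t t0.
- exact: cvg_cst.
- by rewrite -[X in _ --> X]addr0; apply: cvgD;
    [exact: cvg_cst|exact: cvg_harmonic].
Unshelve. all: by end_near. Qed.

Section discount.
Context {R : realType}.
Variable delta : R.
Hypothesis delta0 : 0 < delta.
Local Notation mu := (@lebesgue_measure R).
Local Notation disc := (fun t : R => expR (- delta * t)).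

Lemma discount_continuous : continuous disc.
Proof.
move=> t; apply: continuous_comp; last exact: continuous_expR.
by apply: cvgM; [exact: cvg_cst|exact: cvg_id].
Qed.

Lemma ereal_integral_discount a :
  (\int[mu]_(t in `[a, +oo[) (disc t)%:E = (disc a / delta)%:E)%E.
Proof.
pose F t := - (disc t / delta).
have dF (t : R) : is_derive t (1 : R) F (disc t).
  rewrite (_ : F = fun t => - delta^-1 * expR (- delta * t)).
    apply: is_derive_eq.
    rewrite /GRing.scale/= ?mulr1 ?mulr0 ?add0r ?addr0; field.
    by rewrite gt_eqF.
  by apply/funext => s; rewrite /F; field; rewrite gt_eqF.
rewrite (@ge0_continuous_FTC2y _ disc F _ 0).
- by rewrite sub0e EFinN oppeK.
- by move=> t _; exact: expR_ge0.
- by apply: continuous_subspaceT; exact: discount_continuous.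
- rewrite -oppr0; apply: cvgN; rewrite -(mul0r delta^-1).
  apply: cvgM; last exact: cvg_cst.
  rewrite (_ : disc = (fun z => expR (- z)) \o (fun z => delta * z)); last first.
    by apply: eq_fun => x; rewrite mulNr.
  apply: (@cvg_comp _ _ _ _ _ _ (pinfty_nbhs R)); last exact: cvgr_expR.
  exact: gt0_cvgMry.
- by move=> t _.
- apply: cvgN; apply: cvgM; last exact: cvg_cst.
  by apply: cvg_at_right_filter; exact: discount_continuous.
- by move=> t _; rewrite derive1E derive_val.
Qed.

Lemma integrable_discount a : mu.-integrable `[a, +oo[ (EFin \o disc).
Proof.
apply/integrableP; split.
  apply/measurable_EFinP; apply: measurable_funTS.
  by apply: continuous_measurable_fun; exact: discount_continuous.
under eq_integral do rewrite /= ger0_norm ?expR_ge0//.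
by rewrite ereal_integral_discount ltry.
Qed.

Lemma integral_discount a :
  \int[mu]_(t in `[a, +oo[) disc t = disc a / delta.
Proof. by rewrite /Rintegral ereal_integral_discount. Qed.

(** [M] times the discount factor dominates the integrand. *)
Lemma integrable_discounted (D : set R) (f : R -> R) M :
  measurable D -> D `<=` `[0, +oo[ -> measurable_fun D f ->
  (forall t, D t -> `|f t| <= M) ->
  mu.-integrable D (EFin \o (fun t => disc t * f t)).
Proof.
move=> mD D0 mf fM.
have mdisc : measurable_fun D disc.
  apply: measurable_funTS; apply: continuous_measurable_fun.
  exact: discount_continuous.
have iM : mu.-integrable D (EFin \o (fun t => M * disc t)).
  rewrite (_ : _ \o _ = fun t => M%:E * (EFin \o disc) t)%E//.
  apply: integrableZl => //.
  by apply: integrableS (integrable_discount 0) => //; exact: measurable_itv.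
apply: le_integrable iM => //.
  by apply/measurable_EFinP; exact: measurable_funM.
move=> t Dt; rewrite lee_fin !normrM mulrC (ger0_norm (expR_ge0 _)).
by rewrite ler_pM2r ?expR_gt0// (le_trans (fM t Dt))// ler_norm.
Qed.

End discount.

Section discounted_estimate.
Context {R : realType}.
Variable delta : R.
Hypothesis delta0 : 0 < delta.
Local Notation mu := (@lebesgue_measure R).
Local Notation disc := (fun t : R => expR (- delta * t)).

(** The three terms bound the contributions of the times at which [u] is small,
    of the exceptional set [B], and of the times beyond the horizon [T]. *)
Lemma discounted_integral_small (u : R -> R) (B : set R) (T K c b : R) :
  0 <= T -> 0 <= K -> 0 <= c -> measurable B -> (mu B <= b%:E)%E ->
  measurable_fun (`[0, +oo[ : set R) u ->
  (forall t, 0 <= t -> `|u t| <= K) ->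
  (forall t, 0 <= t < T -> ~ B t -> `|u t| <= c) ->
  `|\int[mu]_(t in `[0, +oo[) (disc t * u t)|
    <= c / delta + K * b + K * (disc T / delta).
Proof.
move=> T0 K0 c0 mB Bb mf uK uc.
have mI (a : R) : measurable (`[a, +oo[ : set R) by exact: measurable_itv.
have mdisc : measurable_fun (`[0, +oo[ : set R) disc.
  apply: measurable_funTS; apply: continuous_measurable_fun.
  exact: discount_continuous.
have iu : mu.-integrable `[0, +oo[ (EFin \o (fun t => disc t * u t)).
  apply: (@integrable_discounted _ _ delta0 _ _ K) => //.
  by move=> t; rewrite /= in_itv/= andbT; exact: uK.
rewrite -lee_fin EFin_normr_Rintegral//.
apply: le_trans (le_abse_integral _ _ (measurable_int mu iu)) _ => //.
pose F1 t := (c * disc t)%:E.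
pose F2 t := (K * \1_B t)%:E.
pose F3 := (fun t => (K * disc t)%:E) \_ `[T, +oo[.
have F10 t : (0 <= F1 t)%E by rewrite lee_fin mulr_ge0// expR_ge0.
have F20 t : (0 <= F2 t)%E by rewrite lee_fin mulr_ge0.
have F30 t : (0 <= F3 t)%E.
  by rewrite /F3 patchE; case: ifPn => // _; rewrite lee_fin mulr_ge0// expR_ge0.
have mF1 : measurable_fun (`[0, +oo[ : set R) F1.
  by apply/measurable_EFinP; apply: measurable_funM => //; exact: measurable_cst.
have mF2 : measurable_fun (`[0, +oo[ : set R) F2.
  apply/measurable_EFinP; apply: measurable_funM; first exact: measurable_cst.
  by apply: measurable_funTS; exact: measurable_indic.
have mF3 : measurable_fun (`[0, +oo[ : set R) F3.
  apply: measurable_funTS; apply/(measurable_restrictT _ _).1 => //.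
  apply/measurable_EFinP; apply: measurable_funM; first exact: measurable_cst.
  apply: measurable_funTS; apply: continuous_measurable_fun.
  exact: discount_continuous.
apply: (@le_trans _ _ (\int[mu]_(t in `[0%R, +oo[) (F1 t + F2 t + F3 t))%E).
  apply: ge0_le_integral => //.
  - by apply: measurableT_comp => //; exact: measurable_int iu.
  - by apply: emeasurable_funD => //; exact: emeasurable_funD.
  move=> t; rewrite /= in_itv/= andbT => t0.
  rewrite /= normrM (ger0_norm (expR_ge0 _)) /F1 /F2 /F3 patchE.
  have d0 := expR_gt0 (- delta * t).
  have d1 : disc t <= 1 by rewrite -expR0 ler_expR mulNr oppr_le0 mulr_ge0// ltW.
  case: ifPn => [_|].
    rewrite lee_fin.
    have := uK t t0; have : 0 <= c * disc t by rewrite mulr_ge0// ltW.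
    have : 0 <= K * \1_B t by rewrite mulr_ge0.
    by nra.
  rewrite notin_setE/= in_itv/= andbT => /negP; rewrite -ltNge => tT.
  rewrite adde0 lee_fin indicE; case: (boolP (t \in B)) => [_|].
    by rewrite mulr1; have := uK t t0; have : 0 <= c * disc t;
      [rewrite mulr_ge0// ltW|nra].
  rewrite notin_setE => /uc; rewrite t0 tT => /(_ isT).
  by rewrite mulr0 addr0 mulrC ler_pM2r.
rewrite ge0_integralD//; last 2 first.
  by move=> t _; rewrite adde_ge0.
  exact: emeasurable_funD.
rewrite ge0_integralD// !EFinD; apply: leeD; first apply: leeD.
- rewrite /F1; under eq_integral do rewrite EFinM.
  rewrite ge0_integralZl//; last exact/measurable_EFinP.
  by rewrite ereal_integral_discount// mulr0 expR0 -EFinM div1r.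
- rewrite /F2; under eq_integral do rewrite EFinM.
  rewrite ge0_integralZl//; last first.
    by apply/measurable_EFinP; apply: measurable_funTS; exact: measurable_indic.
  rewrite integral_indic// EFinM lee_wpmul2l//.
  apply: le_trans Bb; apply: le_measure; rewrite ?inE//.
  exact: measurableI.
- rewrite /F3 -integral_mkcondr setIidr; last first.
    move=> t; rewrite /= !in_itv/= !andbT; exact: le_trans.
  under eq_integral do rewrite EFinM.
  rewrite ge0_integralZl//; last first.
    apply/measurable_EFinP; apply: measurable_funTS.
    by apply: continuous_measurable_fun; exact: discount_continuous.
  by rewrite ereal_integral_discount// -EFinM.
Qed.

End discounted_estimate.

(** * Continuity for the Skorokhod topology *)

Section oscillation.
Context {R : realType} {U : uniformType}.
Variable h : U -> R.
Hypothesis hc : continuous h.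

(** Both [v] and [y] are close to [z]; the form of the hypotheses is the one met
    along a path, with [z] a one-sided limit of the path, [v] and [u] two of its
    values near that limit, and [y] the value of a neighbouring path. *)
Lemma continuous_entourage z (eps : R) : 0 < eps ->
  exists2 B : set (U * U), entourage B &
    forall v u y, B (z, v) -> B (z, u) -> B (u, y) -> `|h y - h v| < eps.
Proof.
move=> eps0; have e2 : 0 < eps / 2 by rewrite divr_gt0.
have : nbhs z [set u | `|h z - h u| < eps / 2].
  by move: (hc (x := z)) => /cvgrPdist_lt/(_ _ e2).
rewrite -nbhs_entourageE => -[A entA AP].
exists (split_ent A) => [|v u y zv zu uy]; first exact: entourage_split_ent.
have hy : `|h z - h y| < eps / 2.
  by apply: AP; apply/xsectionP; exact: (entourage_split u).
have hv : `|h z - h v| < eps / 2.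
  apply: AP; apply/xsectionP; apply: (entourage_split v) => //.
  exact: entourage_refl v (entourage_split_ent entA).
by move: hy hv; rewrite !ltr_norml => /andP[? ?] /andP[? ?]; lra.
Qed.

Variable f : R -> U.
Hypothesis fc : cadlag f.
Variable eps : R.
Hypothesis eps0 : 0 < eps.

(** At a time within [e] of [s], the path may be replaced by any [A]-close
    point without moving [h] by [eps] from its value at [s]. *)
Let small_osc (A : set (U * U)) (e s : R) := forall (r : R) y,
  0 <= r -> `|r - s| < e -> A (f r, y) -> `|h y - h (f s)| < eps.

(** The path may jump at [t] itself, so only times [s] at distance at least [e]
    from [t] are considered: the times within [e] of [s] are then on the same
    side of [t] as [s], where the path is close to its one-sided limit. *)
Lemma cadlag_osc_at (t : R) : 0 <= t ->
  exists eA : R * set (U * U), [/\ 0 < eA.1, entourage eA.2 &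
    forall s e, 0 <= s -> `|s - t| < eA.1 -> e <= eA.1 -> e <= `|s - t| ->
      small_osc eA.2 e s].
Proof.
move=> t0; have [fr fl _] := fc.
have [d1 [A1 [d10 entA1 P1]]] : exists d1 A1, [/\ 0 < d1, entourage A1 &
    forall s r y, t < s < t + d1 -> t < r < t + d1 -> A1 (f r, y) ->
      `|h y - h (f s)| < eps].
  have [B entB BP] := continuous_entourage (f t) eps0.
  have /cvg_app_entourageP/(_ B entB)[d /= d0 dP] := fr t t0.
  exists d, B; split=> // s r y /andP[ts sd] /andP[tr rd].
  apply: BP; apply: dP => //=.
    by rewrite ltr_norml; lra.
  by rewrite ltr_norml; lra.
have [d2 [A2 [d20 entA2 P2]]] : exists d2 A2, [/\ 0 < d2, entourage A2 &
    forall s r y, 0 <= s -> 0 <= r -> t - d2 < s < t -> t - d2 < r < t ->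
      A2 (f r, y) -> `|h y - h (f s)| < eps].
  (* at time 0 there is no left side, as all times are nonnegative *)
  move: t0; rewrite le_eqVlt => /predU1P[<-|t0].
    exists 1, setT; split=> //; first exact: entourageT.
    by move=> s r y s0 _ /andP[_]; rewrite ltNge s0.
  have [z fz] := fl t t0.
  have [B entB BP] := continuous_entourage z eps0.
  have /cvg_app_entourageP/(_ B entB)[d /= d0 dP] := fz.
  exists d, B; split=> // s r y _ _ /andP[ts sd] /andP[tr rd].
  apply: BP; apply: dP => //=.
    by rewrite ltr_norml; lra.
  by rewrite ltr_norml; lra.
exists (Num.min d1 d2 / 2, A1 `&` A2); split=> /=.
- by rewrite divr_gt0// lt_min d10.
- exact: filterI.
move=> s e s0 st ed es r y r0 rs [A1y A2y].
have m1 : Num.min d1 d2 <= d1 by rewrite ge_min lexx.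
have m2 : Num.min d1 d2 <= d2 by rewrite ge_min lexx orbT.
rewrite ltr_norml in st; rewrite ltr_norml in rs.
move: es; rewrite ler_normr => /orP[es|es].
  by apply: (P1 s r) => //; lra.
by apply: (P2 s r) => //; lra.
Qed.

(** By compactness of [0, T], finitely many of the neighbourhoods given by
    [cadlag_osc_at] suffice; [D] collects their centres. *)
Lemma cadlag_osc (T : R) : exists (D : seq R) (e0 : R) (A : set (U * U)),
  [/\ 0 < e0, entourage A &
    forall s e, 0 <= s <= T -> e <= e0 -> (forall d, d \in D -> e <= `|s - d|) ->
      small_osc A e s].
Proof.
have /choice[eA eAP] t : exists eA : R * set (U * U),
    [/\ 0 < eA.1, entourage eA.2 & 0 <= t ->
    forall s e, 0 <= s -> `|s - t| < eA.1 -> e <= eA.1 -> e <= `|s - t| ->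
      small_osc eA.2 e s].
  have [t0|t0] := boolP (0 <= t).
    by have [eA [? ? ?]] := cadlag_osc_at t0; exists eA.
  by exists (1, setT); split=> //; exact: entourageT.
have := @segment_compact R 0 T; rewrite compact_cover.
move=> /(_ R `[0, T]%classic (fun t => ball t (eA t).1)) [].
- by move=> t _; exact: ball_open.
- by move=> t tT; exists t => //; apply: ballxx; have [] := eAP t.
move=> D DT Dcov.
have [e0 [A [e00 entA AP]]] : exists (e0 : R) (A : set (U * U)),
    [/\ 0 < e0, entourage A &
    forall d, d \in finmap.enum_fset D -> e0 <= (eA d).1 /\ A `<=` (eA d).2].
  elim: (finmap.enum_fset D) => [|d D' [e0 [A [e00 entA AP]]]].
    by exists 1, setT; split=> //; exact: entourageT.
  have [d0 entd _] := eAP d.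
  exists (Num.min e0 (eA d).1), (A `&` (eA d).2); split.
  - by rewrite lt_min e00.
  - exact: filterI.
  move=> d'; rewrite inE => /predU1P[->|/AP[ed Ad]].
    by rewrite ge_min lexx orbT; split=> // p [].
  by rewrite ge_min ed; split=> // p [/Ad].
exists (finmap.enum_fset D), e0, A; split=> // s e sT ee0 sD r y r0 rs Ay.
have [|d /= dD ds] := Dcov s; first by rewrite /= in_itv.
have [ed Ad] := AP d dD; have [_ _ dP] := eAP d.
have := DT d dD; rewrite inE/= in_itv/= => /andP[d0 _].
apply: (dP d0 s e _ _ _ _ r) => //.
- by case/andP: sT.
- by rewrite distrC.
- exact: le_trans ee0 ed.
- exact: sD.
- exact: Ad.
Qed.

End oscillation.

Section discounted_value.
Context {R : realType} {U : uniformType}.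
Variable delta : R.
Hypothesis delta0 : 0 < delta.
Variable h : U -> R.
Hypotheses (hc : continuous h) (hb : bounded_fun h).

Definition discounted_value (f : skorokhod R U) : R :=
  \int[lebesgue_measure]_(t in `[0, +oo[) (expR (- delta * t) * h (f t)).

Lemma cadlag_comp_measurable (g : U -> R) (f : skorokhod R U) :
  continuous g -> measurable_fun (`[0, +oo[ : set R) (g \o f).
Proof.
move=> gc; apply: right_continuous_measurable => t t0.
have [fr _ _] := path_cadlag f.
exact: cvg_comp (fr t t0) (gc (f t)).
Qed.

Lemma bounded_fun_le {T : Type} (g : T -> R) : bounded_fun g ->
  exists2 M : R, 0 < M & forall u, `|g u| <= M.
Proof.
move=> [M [_ gM]]; exists (`|M| + 1); first by rewrite ltr_wpDl.
by move=> u; apply: gM => //; rewrite ltr_pwDr// ler_norm.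
Qed.

Lemma integrable_discounted_path (g : U -> R) (f : skorokhod R U) :
  continuous g -> bounded_fun g ->
  lebesgue_measure.-integrable (`[0, +oo[ : set R)
    (EFin \o (fun t => expR (- delta * t) * g (f t))).
Proof.
move=> gc /bounded_fun_le[M _ gM].
apply: (@integrable_discounted _ _ delta0 `[0, +oo[%classic (g \o f) M) => //;
  last by move=> t _; exact: gM.
exact: cadlag_comp_measurable.
Qed.

Lemma lebesgue_measure_near_seq (D : seq R) (e : R) : 0 <= e ->
  exists B : set R, [/\ measurable B,
    (lebesgue_measure B <= ((size D)%:R * (2 * e))%:E)%E &
    forall s d, d \in D -> `|s - d| < e -> B s].
Proof.
move=> e0; elim: D => [|d D [B [mB Be BP]]].
  by exists set0; split=> //; rewrite measure0 mul0r.
exists (B `|` ball d e); split.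
- by apply: measurableU => //; exact: measurable_ball.
- apply: le_trans (measureU2 _ _ _) _ => //; first exact: measurable_ball.
  have be : (lebesgue_measure (ball d e) <= (2 * e)%:E)%E.
    by rewrite lebesgue_measure_ball// mulr_natl.
  by rewrite /= -natr1 mulrDl mul1r EFinD; exact: leeD Be be.
- move=> s d'; rewrite inE => /predU1P[->|d'D] sd.
    by right; rewrite /ball/= distrC.
  by left; exact: BP sd.
Qed.

Lemma discount_le (c : R) : 0 < c -> exists2 T, 0 <= T & expR (- delta * T) <= c.
Proof.
move=> c0.
(* with this [T], [expR (delta * T) >= 1 + delta * T >= c^-1] *)
exists (delta^-1 * c^-1); first by rewrite mulr_ge0// invr_ge0 ltW.
rewrite mulNr mulrA divff ?gt_eqF// mul1r expRN -[leRHS]invrK.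
rewrite lef_pV2 ?posrE ?invr_gt0 ?expR_gt0//.
by apply: le_trans (expR_ge1Dx _); rewrite lerDr.
Qed.

Lemma discounted_value_bounded : bounded_fun discounted_value.
Proof.
have [M M0 hM] := bounded_fun_le hb.
exists (M / delta); split; first exact: num_real.
move=> x Mx f _; apply: le_trans (ltW Mx).
have := @discounted_integral_small R _ delta0 (h \o f) set0 0 M 0 0.
rewrite /discounted_value !mulr0 !mul0r expR0 !add0r div1r; apply => //.
- exact: ltW.
- by rewrite measure0.
- exact: cadlag_comp_measurable.
- by move=> t _; exact: hM.
- by move=> t /andP[t0 /(le_lt_trans t0)]; rewrite ltxx.
Qed.

(** Given [eps], the horizon [T], the small oscillation of [h \o f] and the
    closeness [e] of the time change are chosen so that each of the three terms
    of [discounted_integral_small] is at most [eps / 4]. *)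
Lemma discounted_value_continuous : continuous discounted_value.
Proof.
have [M M0 hM] := bounded_fun_le hb.
move=> f; have Ff : Filter (nbhs f) by exact: nbhs_filter.
apply/(@cvgrPdist_lt _ _ _ _ Ff) => eps eps0.
pose K := 2 * M; have K0 : 0 < K by rewrite mulr_gt0.
have [|T T0 discT] := @discount_le (eps * delta / (4 * K)).
  by rewrite divr_gt0 ?mulr_gt0.
have c0 : 0 < eps * delta / 4 by rewrite divr_gt0 ?mulr_gt0.
have [D [e0 [A [e00 entA DP]]]] := cadlag_osc hc (path_cadlag f) c0 T.
pose e1 := eps / (4 * K) / (2 * (size D).+1%:R).
have e10 : 0 < e1 by rewrite !divr_gt0 ?mulr_gt0.
pose e := Num.min (Num.min e0 1) e1.
have e_gt0 : 0 < e by rewrite !lt_min e00 ltr01.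
have [ee0 ele1 ee1] : [/\ e <= e0, e <= 1 & e <= e1].
  by rewrite /e !ge_min !lexx !orbT.
(* the horizon is [T + 1] since the time change may move [T] by [e <= 1] *)
have entW : entourage (skorokhod_close (T + 1) e A :
    set (skorokhod R U * skorokhod R U)).
  by exists (T + 1), e, A; split=> //; lra.
apply: (@filterS _ (nbhs f) _ _ _ _ (nbhs_entourage f entW)).
move=> g /xsectionP/= [mu [[fmu imu smu] mui] muP].
have [B [mB Be BP]] := lebesgue_measure_near_seq D (ltW e_gt0).
rewrite /discounted_value -RintegralB//; last 2 first.
  exact: integrable_discounted_path.
  exact: integrable_discounted_path.
under eq_Rintegral do rewrite -mulrBr.
apply: le_lt_trans (@discounted_integral_small R _ delta0
  (fun t => h (f t) - h (g t)) B T K (eps * delta / 4)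
  ((size D)%:R * (2 * e)) T0 (ltW K0) (ltW c0) mB Be _ _ _) _.
- by apply: measurable_funB; exact: cadlag_comp_measurable.
- move=> t _; rewrite (le_trans (ler_normB _ _))// /K mulr2n mulrDl !mul1r.
  by rewrite lerD.
- move=> s /andP[s0 sT] nBs.
  (* [r] is the time at which [f] is compared with the value of [g] at [s] *)
  have [r r0 rs] := smu s s0.
  have rT : r <= T + 1.
    rewrite leNgt; apply/negP => Tr.
    have T1 : 0 <= T + 1 by lra.
    have := mui (T + 1) r; rewrite !inE => /(_ T1 r0 Tr); rewrite rs.
    have [|+ _ Ts] := muP (T + 1); first by rewrite T1 lexx.
    by rewrite ltr_norml => /andP[? ?]; lra.
  have [|rd Ar] := muP r; first by rewrite r0 rT.
  rewrite rs in rd Ar.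
  rewrite distrC ltW//; apply: (DP s e _ ee0 _ r) => //.
  + by rewrite s0 ltW.
  + move=> d dD; rewrite leNgt; apply/negP => sd; exact/nBs/(BP s d).
  + by rewrite distrC.
have h1 : eps * delta / 4 / delta = eps / 4 by field; rewrite gt_eqF.
have h2 : K * ((size D)%:R * (2 * e)) <= eps / 4.
  apply: (@le_trans _ _ (K * ((size D).+1%:R * (2 * e1)))).
    apply: ler_wpM2l; first exact: ltW.
    by apply: ler_pM; rewrite ?mulr_ge0 ?ler_nat ?ler_pM2l ?(ltW e_gt0).
  rewrite /e1 le_eqVlt; apply/orP; left; apply/eqP; field.
  by rewrite !gt_eqF.
have h3 : K * (expR (- delta * T) / delta) <= eps / 4.
  rewrite mulrA ler_pdivrMr// -ler_pdivlMl//.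
  apply: le_trans discT _; rewrite le_eqVlt; apply/orP; left; apply/eqP; field.
  by rewrite !gt_eqF.
by rewrite h1; lra.
Qed.

End discounted_value.

(** * Integrals of almost everywhere equal functions *)

Section integral_ae.
Import HBNNSimple.
Context d (T : measurableType d) (R : realType).
Variable mu : {measure set T -> \bar R}.
Local Open Scope ereal_scope.

(** A simple function below [f] is cut off on the exceptional null set: it then
    lies below [g], and its integral is unchanged. *)
Let le_ae (f g : T -> \bar R) : (forall x, 0 <= f x) -> (forall x, 0 <= g x) ->
  {ae mu, forall x, f x = g x} -> \int[mu]_x f x <= \int[mu]_x g x.
Proof.
move=> f0 g0 [N [mN N0 Nfg]].
rewrite ge0_integralTE// ge0_integralTE//; apply/ge_ereal_sup => _ [k kf <-].
pose k' := mul_nnsfun k (indic_nnsfun R (measurableC mN)).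
have k'E x : k' x = (k x * \1_(~` N) x)%R by [].
suff -> : sintegral mu k = sintegral mu k'.
  apply: ereal_sup_ubound; exists k' => // x; rewrite k'E indicE.
  case: (boolP (x \in ~` N)) => [|_]; last by rewrite mulr0.
  rewrite inE mulr1 => Nx.
  have <- : f x = g x by apply: contrapT => ne; exact: Nx (Nfg x ne).
  exact: kf.
rewrite -!integralT_nnsfun; apply: ae_eq_integral => //.
- by apply/measurable_EFinP; exact: measurable_funP.
- by apply/measurable_EFinP; exact: measurable_funP.
exists N; split=> // x /= ne; apply: contrapT => Nx; apply: ne => _.
by congr EFin; rewrite [RHS]k'E indicE mem_set ?mulr1.
Qed.

(** This covers functions that are not measurable, because the integral of any
    nonnegative function is a supremum over the simple functions below it. *)
Lemma integral_ae_eq (f g : T -> \bar R) :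
  {ae mu, forall x, f x = g x} -> \int[mu]_x f x = \int[mu]_x g x.
Proof.
move=> fg; rewrite integralE [in RHS]integralE.
have part (p : (T -> \bar R) -> T -> \bar R) :
    (forall u x, 0 <= p u x) -> (forall u v x, u x = v x -> p u x = p v x) ->
    \int[mu]_x p f x = \int[mu]_x p g x.
  move=> p0 pE; apply/eqP; rewrite eq_le; apply/andP; split; apply: le_ae => //.
    by apply: filterS fg => x; exact: pE.
  by apply: filterS fg => x /esym; exact: pE.
congr (_ - _).
  by apply: (part (fun u => u^\+)) => // u v x; rewrite !funeposE => ->.
by apply: (part (fun u => u^\-)) => // u v x; rewrite !funenegE => ->.
Qed.

End integral_ae.

(** * The reward of an absorbed path *)

(** The terminal cost enters as the rate [delta * Psi] of the perpetual payment
    whose discounted value is [Psi]. *)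
Definition annuity_reward {R : realType} {T : Type} (delta : R)
  (l Psi : T -> R) (y : T) : R := l y + delta * Psi y.

Section absorbed_path.
Context {R : realType} {S : state_space R}.
Variable Kc : {set mode S}.

Definition absorbed (f : skorokhod R (state S)) : Prop :=
  (forall t, 0 <= t -> ~ cemetery Kc (f t)) \/
  exists a, [/\ 0 <= a, cemetery Kc (f a),
    forall t, 0 <= t < a -> ~ cemetery Kc (f t) &
    forall t, a <= t -> f t = f a].

Variables (delta : R) (l Psi : state S -> R).
Hypothesis delta0 : 0 < delta.
Hypotheses (lK : running_reward Kc l) (PsiK : terminal_cost Kc Psi).
Hypotheses (lc : continuous l) (lb : bounded_fun l).
Hypotheses (Psic : continuous Psi) (Psib : bounded_fun Psi).

Local Notation h := (annuity_reward delta l Psi).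

Lemma annuity_continuous : continuous h.
Proof.
move=> y; apply: cvgD; first exact: lc.
by apply: cvgM; [exact: cvg_cst|exact: Psic].
Qed.

Lemma annuity_bounded : bounded_fun h.
Proof.
have [M M0 lM] := bounded_fun_le lb; have [N N0 PsiN] := bounded_fun_le Psib.
exists (M + delta * N); split; first exact: num_real.
move=> e Me y _; apply: le_trans (ltW Me).
rewrite (le_trans (ler_normD _ _))// normrM (ger0_norm (ltW delta0)).
by rewrite lerD// ler_pM2l.
Qed.

(** After absorption only the perpetual payment [delta * Psi] remains; its
    discounted value at the hitting time is the terminal cost. *)
Lemma total_reward_absorbed f : absorbed f ->
  total_reward Kc delta l Psi f = discounted_value delta h f.
Proof.
case=> [noK|[a [a0 Ka noK fa]]]; rewrite /total_reward /discounted_value.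
  have -> : hitting_time Kc f = +oo%E.
    rewrite /hitting_time (_ : [set t | _] = set0) ?image_set0 ?ereal_inf0//.
    by apply/seteqP; split=> // t [/noK].
  rewrite ltxx addr0.
  rewrite (_ : [set t | _] = `[0, +oo[%classic); last first.
    apply/seteqP; split=> t; rewrite /= in_itv/= ?andbT.
      by case.
    by split=> //; rewrite leey.
  apply: eq_Rintegral => t; rewrite inE/= in_itv/= andbT => t0.
  by rewrite /annuity_reward (PsiK.2 _ (noK t t0)) mulr0 addr0.
have -> : hitting_time Kc f = a%:E.
  apply/eqP; rewrite eq_le; apply/andP; split.
    by apply: ereal_inf_lbound; exists a.
  apply: le_ereal_inf_tmp => _ [t [t0 Kt] <-].
  rewrite lee_fin leNgt; apply/negP => ta.
  by apply: noK Kt; rewrite t0.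
rewrite ltry/=.
have iU : lebesgue_measure.-integrable (`[0, a[ `|` `[a, +oo[ : set R)
    (EFin \o (fun t => expR (- delta * t) * h (f t))).
  have -> : (`[0, a[ `|` `[a, +oo[)%classic = `[0, +oo[%classic :> set R.
    by rewrite -itv_bndbnd_setU// bnd_simp.
  by apply: integrable_discounted_path => //;
    [exact: annuity_continuous|exact: annuity_bounded].
rewrite (_ : [set` `[0, +oo[] = `[0, a[%classic `|` `[a, +oo[%classic); last first.
  by rewrite -itv_bndbnd_setU// bnd_simp.
rewrite Rintegral_setU//; last first.
  apply/disj_setPS => t [/=]; rewrite !in_itv/= andbT => /andP[_ ta].
  by rewrite leNgt ta.
congr (_ + _).
  rewrite (_ : [set t | 0 <= t /\ (t%:E <= a%:E)%E] = `[0, a]%classic); last first.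
    apply/seteqP; split=> t; rewrite /= in_itv/= lee_fin; first by case=> -> ->.
    by move=> /andP[].
  rewrite -Rintegral_itv_bndo_bndc; last first.
    apply: integrableS (integrable_discounted_path delta0 f lc lb) => //.
    exact: subset_itvl.
  apply: eq_Rintegral => t; rewrite inE/= in_itv/= => ta.
  by rewrite /annuity_reward (PsiK.2 _ (noK t ta)) mulr0 addr0.
transitivity (\int[lebesgue_measure]_(t in `[a, +oo[)
    (delta * Psi (f a) * expR (- delta * t))).
  rewrite RintegralZl//; last exact: integrable_discount.
  by rewrite integral_discount//; field; rewrite gt_eqF.
apply: eq_Rintegral => t; rewrite inE/= in_itv/= andbT => ta.
by rewrite /annuity_reward (fa t ta) (lK.2 _ Ka) add0r mulrC.
Qed.

End absorbed_path.

(** * Absorption in the cemetery *)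

Section cemetery_absorbs.
Context {R : realType} {S : state_space R}.
Variable Kc : {set mode S}.

Lemma cemetery_measurable : measurable (cemetery Kc : set (state S)).
Proof.
apply: sub_sigma_algebra; apply/sigT_openP => k /=.
have [kK|kK] := boolP (k \in Kc).
  rewrite (_ : _ @^-1` _ = setT); first exact: openT.
  by apply/seteqP; split.
rewrite (_ : _ @^-1` _ = set0); first exact: open0.
by apply/seteqP; split=> // y /=; rewrite /cemetery/= (negbTE kK).
Qed.

Lemma ambient_inj : injective (@ambient R S).
Proof.
move=> [k y] [k' y'] e; have /= kk' := existT_inj1 e.
case: _ / kk' y' e => y' e; have e2 : val y = val y' := existT_inj2 e.
by rewrite (val_inj e2).
Qed.

Variable C : characteristics S.
Hypothesis (CK : is_cemetery C Kc).

Lemma flow_at_cemetery x t : cemetery Kc x -> flow_at C x t = ambient x.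
Proof. by move=> Kx; rewrite /flow_at (CK Kx).2. Qed.

(** Every point of a mode in [Kc] has intensity 0, so the intensity along the
    flow vanishes wherever the flow goes. *)
Lemma survival_cemetery x t : exit_time C x = +oo%E -> cemetery Kc x ->
  survival C x t = 1.
Proof.
move=> ex Kx; rewrite /survival ex ltry.
have -> : intensity_along C x = cst 0.
  apply/funext => r; rewrite /intensity_along /= oinv_set_val.
  by case: insubP => //= y _ _; exact: (@CK (pt y) Kx).1.
by rewrite Rintegral_cst// mul0r oppr0 expR0.
Qed.

(** The statement for one outcome, with [X] its path and [T] its jump times.
    Only rational observation times are used, so that the hypothesis that no
    jump follows a visit to the cemetery is a countable family of events. *)
Lemma jumpless_cemetery_absorbed (X : skorokhod R (state S))
    (T : nat -> \bar R) :
  T 0%N = 0%E -> (forall n, T n <= T n.+1)%E -> T @ \oo --> +oo%E ->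
  (forall n t, (T n <= t%:E < T n.+1)%E ->
    ambient (X t) = flow_at C (X (fine (T n))) (t - fine (T n))) ->
  (forall n (q : rat) (k : nat), 0 <= ratr q :> R -> cemetery Kc (X (ratr q)) ->
    (T n <= (ratr q)%:E < T n.+1)%E -> ((ratr q + k.+1%:R)%:E < T n.+1)%E) ->
  absorbed Kc X.
Proof.
move=> T0 Tnd Toy flowE noJ.
have Tmono m n : (m <= n)%N -> (T m <= T n)%E.
  by move=> mn; apply: (homo_leq (r := fun x y => (x <= y)%E)) mn => //;
    exact: le_trans.
have T_ge0 n : (0 <= T n)%E by rewrite -T0 Tmono.
have index t : 0 <= t -> exists n, (T n <= t%:E < T n.+1)%E.
  move=> t0; have exT : exists n, (t%:E < T n)%E.
    have /cvgeyPgt/(_ t)[N _ NT] := Toy.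
    by exists N; apply: NT => /=.
  case: (ex_minnP exT) => -[|n] tn min_n.
    by move: tn; rewrite T0 lte_fin ltNge t0.
  exists n; rewrite tn andbT leNgt; apply/negP => /min_n.
  by rewrite ltnn.
have tagE n t : (T n <= t%:E < T n.+1)%E -> tag (X t) = tag (X (fine (T n))).
  by move=> /flowE; exact: existT_inj1.
have stuck n t : 0 <= t -> cemetery Kc (X t) -> (T n <= t%:E < T n.+1)%E ->
    [/\ T n = (fine (T n))%:E, T n.+1 = +oo%E, cemetery Kc (X (fine (T n))) &
      forall s, fine (T n) <= s -> X s = X (fine (T n))].
  move=> t0 Kt tn; have /andP[Tnt tTn] := tn.
  have Tfin : T n = (fine (T n))%:E.
    by rewrite fineK// ge0_fin_numE// (le_lt_trans Tnt)// ltry.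
  have KTn : cemetery Kc (X (fine (T n))) by rewrite /cemetery/= -(tagE n t).
  have Toon : T n.+1 = +oo%E.
    have [b tb bT] : exists2 b, t < b & (b%:E <= T n.+1)%E.
      case: (T n.+1) tTn => [r tr| |//]; first by exists r.
      by move=> _; exists (t + 1); rewrite ?leey// ltrDl.
    have [q] := rat_in_itvoo tb; rewrite in_itv/= => /andP[tq qb].
    have qn : (T n <= (ratr q)%:E < T n.+1)%E.
      rewrite (le_trans Tnt) ?lee_fin ?(ltW tq)//=.
      by rewrite (lt_le_trans _ bT)// lte_fin.
    have Kq : cemetery Kc (X (ratr q)) by rewrite /cemetery/= (tagE n).
    have q0 : 0 <= ratr q :> R by rewrite (le_trans t0)// ltW.
    (* a finite [T n.+1] would be passed by [ratr q + k.+1] for large [k] *)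
    case E : (T n.+1) => [r| |]; [|by []|by rewrite E in tTn].
    have := noJ n q (Num.truncn (r - ratr q)) q0 Kq qn.
    rewrite E lte_fin -ltrBrDl => /lt_trans/(_ (truncnS_gt _)).
    by rewrite ltxx.
  split=> // s Ts; apply: ambient_inj.
  rewrite -(flow_at_cemetery (s - fine (T n)) KTn); apply: flowE.
  by rewrite Toon ltry andbT Tfin lee_fin.
have [[t0 [t00 Kt0]]|noK] := pselect (exists t, 0 <= t /\ cemetery Kc (X t));
    last by left=> t t0 Kt; apply: noK; exists t.
right; have [n tn] := index t0 t00.
have [Tfin _ KTn XTn] := stuck n t0 t00 Kt0 tn.
exists (fine (T n)); split=> //; first exact: fine_ge0.
move=> t /andP[t0' tT] Kt; have [m tm] := index t t0'.
have [_ Toom _ _] := stuck m t t0' Kt tm.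
have [mn|nm] := ltnP m n.
  have := Tmono _ _ mn; rewrite Toom leye_eq => /eqP Tn.
  by move: tn; rewrite Tn => /andP[]; rewrite leye_eq.
have /andP[+ _] := tm; rewrite leNgt => /negP; apply.
by rewrite (lt_le_trans _ (Tmono _ _ nm))// Tfin lte_fin.
Qed.

Context {d : measure_display} {Om : measurableType d}.
Variables (P : probability Om R) (X : Om -> skorokhod R (state S)).

(** Given a visit to the cemetery at time [s], the next jump comes after [s + t]
    with probability 1, for every [t]; the exceptional null sets are collected
    over rational [s] and integer [t]. *)
Lemma pdmp_absorbed : standing_assumptions C -> is_pdmp P X C ->
  {ae P, forall w, absorbed Kc (X w)}.
Proof.
move=> [_ exitC _ _] [mX _ [T [Y [[mT _] T0 Tae Tsurv _]]]].
have noJ n s t : 0 <= s -> 0 < t -> {ae P, forall w, cemetery Kc (X w s) ->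
    (T n w <= s%:E < T n.+1 w)%E -> ((s + t)%:E < T n.+1 w)%E}.
  move=> s0 t0.
  pose D := [set w | cemetery Kc (X w s) /\ (T n w <= s%:E < T n.+1 w)%E].
  pose E := [set w | ((s + t)%:E < T n.+1 w)%E].
  have mE : measurable E by rewrite -[E]setTI; exact: emeasurable_fun_o_infty.
  have mD : measurable D.
    rewrite (_ : D = ((fun w => X w s) @^-1` cemetery Kc) `&`
      ([set w | (T n w <= s%:E)%E] `&` [set w | (s%:E < T n.+1 w)%E])).
      apply: measurableI.
        by rewrite -[_ @^-1` _]setTI; apply: mX => //; exact: cemetery_measurable.
      apply: measurableI.
        by rewrite -[X in measurable X]setTI; exact: emeasurable_fun_infty_c.
      by rewrite -[X in measurable X]setTI; exact: emeasurable_fun_o_infty.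
    apply/seteqP; split=> w; first by move=> [? /andP[]].
    by move=> [? [? ?]]; split=> //; apply/andP.
  exists (D `\` E); split; first exact: measurableD.
    rewrite measureD//; last by rewrite ltey_eq fin_num_measure.
    have /= -> := Tsurv n s t _ s0 t0 cemetery_measurable.
    rewrite (eq_integral (cst 1%E)); last first.
      by move=> w; rewrite inE => -[Kw _]; rewrite survival_cemetery.
    by rewrite integral_cst// mul1e subee// fin_num_measure.
  move=> w /= nw; apply: contrapT => nDE; apply: nw => Kw Tw.
  by apply: contrapT => nE; apply: nDE.
have noJ_all : {ae P, forall w, forall n (m k : nat),
    let q : rat := odflt 0 (unpickle m) in 0 <= ratr q :> R ->
    cemetery Kc (X w (ratr q)) ->
    (T n w <= (ratr q)%:E < T n.+1 w)%E ->
    ((ratr q + k.+1%:R)%:E < T n.+1 w)%E}.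
  apply: ae_foralln => n; apply: ae_foralln => m; apply: ae_foralln => k /=.
  set q := odflt _ _; have [q0|q0] := boolP (0 <= ratr q :> R).
    by apply: filterS (noJ n _ k.+1%:R q0 (ltr0Sn _ _)) => w + _.
  exact: aeW.
apply: filterS2 Tae noJ_all => w [Too flowE _] noJw.
have [T0w Tnd] := T0 w.
apply: (@jumpless_cemetery_absorbed (X w) (T ^~ w)) => //.
move=> n q k; have := noJw n (pickle q) k; rewrite pickleK; exact.
Qed.

End cemetery_absorbs.

(** * Convergence of the rewards *)

Lemma expectation_total_reward {R : realType} {S : state_space R}
    (Kc : {set mode S}) (C : characteristics S)
    d (Om : measurableType d) (P : probability Om R)
    (X : Om -> skorokhod R (state S)) (l Psi : state S -> R) (delta : R) :
  standing_assumptions C -> is_cemetery C Kc -> is_pdmp P X C ->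
  running_reward Kc l -> terminal_cost Kc Psi ->
  continuous l -> bounded_fun l -> continuous Psi -> bounded_fun Psi ->
  0 < delta ->
  ('E_P[total_reward Kc delta l Psi \o X] =
   'E_P[discounted_value delta (annuity_reward delta l Psi) \o X])%E.
Proof.
move=> Cst CK Xpdmp lK PsiK lc lb Psic Psib delta0.
rewrite !unlock; apply: integral_ae_eq.
apply: filterS (pdmp_absorbed CK Cst Xpdmp) => w Xw /=.
by rewrite (@total_reward_absorbed _ _ Kc).
Qed.

Theorem lemma5p14 (R : realType) (S : state_space R) (Kc : {set mode S})
  (* the limit process *)
  (C : characteristics S)
  (d : measure_display) (Om : measurableType d) (P : probability Om R)
  (X : Om -> skorokhod R (state S))
  (* the approximating processes *)
  (Cn : nat -> characteristics S)
  (dn : nat -> measure_display) (Omn : forall n : nat, measurableType (dn n))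
  (Pn : forall n : nat, probability (Omn n) R)
  (Xn : forall n : nat, Omn n -> skorokhod R (state S))
  (l Psi : state S -> R) (x : state S) (delta : R) :
  standing_assumptions C ->
  (forall n, standing_assumptions (Cn n)) ->
  is_cemetery C Kc ->
  (forall n, is_cemetery (Cn n) Kc) ->
  is_pdmp P X C ->
  (forall n, is_pdmp (Pn n) (@Xn n) (Cn n)) ->
  running_reward Kc l ->
  terminal_cost Kc Psi ->
  continuous l -> bounded_fun l ->
  continuous Psi -> bounded_fun Psi ->
  {ae P, forall w, X w 0 = x} ->
  (forall n, {ae (Pn n), forall w, @Xn n w 0 = x}) ->
  cvg_in_distribution P X Pn Xn ->
  0 < delta ->
  ('E_(Pn n)[total_reward Kc delta l Psi \o @Xn n])%E @[n --> \oo] -->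
    ('E_P[total_reward Kc delta l Psi \o X])%E.
Proof.
move=> Cst Cnst CK CnK Xpdmp Xnpdmp lK PsiK lc lb Psic Psib _ _ Xcvg delta0.
rewrite (expectation_total_reward Cst CK Xpdmp lK PsiK)//.
under eq_cvg => n do
  rewrite (expectation_total_reward (Cnst n) (CnK n) (Xnpdmp n) lK PsiK)//.
have hc := @annuity_continuous R S delta l Psi lc Psic.
have hb := @annuity_bounded R S delta l Psi delta0 lb Psib.
apply: Xcvg.
  exact: discounted_value_continuous.
exact: discounted_value_bounded.
Qed.
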